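(* Let $\Phi$ be a real, additive gain graph of order $n$ and $Q_1,\dots,Q_n\in\mathbb{E}^d$ (with $Q_i\neq Q_j$ for adjacent $i,j$), and let $\mathcal{H}=\mathcal{H}(\Phi;Q_1,\dots,Q_n)$. Let $t$ be an affine flat of $\mathbb{E}^d$, let $\bar Q_1,\dots,\bar Q_k$ be the distinct points among $\mathrm{proj}_tQ_1,\dots,\mathrm{proj}_tQ_n$ (so $k=|\pi(t)|$), where $\bar Q_B$ is indexed by the block $B$ of $\pi(t)$ it comes from. Then, as arrangements of hyperplanes in the Euclidean space $t$, $$\mathcal{H}^t=\mathcal{H}\big(\Phi^{\eta_t}/\pi(t);\bar Q_1,\dots,\bar Q_k\big).$$ If $t$ is a generic affine flat of codimension $d'$, then $\mathcal{L}(\mathcal{H}^t)$ is isomorphic to the poset of all flats of $\mathcal{H}$ of dimension at least $d'$. Furthermore, if $Q_1,\dots,Q_n$ have ideal general position (in $\mathbb{E}^d$), then $\bar Q_1,\dots,\bar Q_k$ also have ideal general position (in $t$).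
   Context: A real, additive gain graph $\Phi$ on $\{1,\dots,n\}$: finite graph (multiple edges allowed, every edge with two distinct endpoints) with gains $\phi(e;i,j)\in\mathbb{R}$, $\phi(e;j,i)=-\phi(e;i,j)$. With $\psi_{ij}(P)=d(P,Q_i)^2-d(P,Q_j)^2$, $\mathcal{H}(\Phi;\mathbf{Q})$ consists of hyperplanes $h(e)=\{P:\psi_{ij}(P)=\phi(e;i,j)\}$, one per edge $e$ with endpoints $i,j$; the same definition applies with reference points in any Euclidean space. Flats of an arrangement are nonempty intersections of subsets of it (including the whole space); $\mathcal{L}(\cdot)$ is the poset of flats under reverse inclusion. Induced arrangement: $\mathcal{H}^t=\{h\cap t:h\in\mathcal{H},\ h\not\supseteq t,\ h\cap t\neq\emptyset\}$. $\mathrm{proj}_t$ is orthogonal projection to $t$; $\pi(t)$ is the partition of $\{1,\dots,n\}$ with $i\sim j$ iff $\mathrm{proj}_tQ_i=\mathrm{proj}_tQ_j$; $\eta_t(i)=d(Q_i,t)^2$. Switching by $\eta:\{1,\dots,n\}\to\mathbb{R}$: $\Phi^\eta$ has the same graph and gains $\phi^\eta(e;i,j)=\phi(e;i,j)-\eta(i)+\eta(j)$. Collapsing by a partition $\pi$: $\Phi/\pi$ has vertex set the blocks of $\pi$, each edge with endpoints $i,j$ becomes an edge with endpoints the blocks $[i],[j]$ with the same gain, and edges with $[i]=[j]$ are deleted. A generic affine flat of codimension $d'$ means one in an open dense subset of the space of such flats. Ideal general position of $m$ points in a $D$-dimensional Euclidean space: the points are distinct and, embedding the space in projective space with ideal hyperplane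 $h_\infty$ and letting $p_{ij}$ be the ideal point of line $Q_iQ_j$, for every set $T$ of unordered pairs the projective span of $\{p_{ij}:\{i,j\}\in T\}$ has dimension $\min(m-c(T),D)-1$, where $c(T)$ is the number of components of the graph $(\{1,\dots,m\},T)$. *)

(* Defs.v *)
From HB Require Import structures.
From mathcomp Require Import all_boot all_order all_algebra.
From mathcomp Require Import all_classical all_reals all_analysis.
Set Implicit Arguments. Unset Strict Implicit. Unset Printing Implicit Defensive.
Import Order.TTheory GRing.Theory Num.Theory.
Import numFieldNormedType.Exports.
Local Open Scope classical_set_scope.
Local Open Scope ring_scope.

Section Defs.
Variables (R : realType) (d : nat).
Notation pt := 'rV[R]_d.

Definition sqd (P Q : pt) : R := \sum_(c < d) (P 0 c - Q 0 c) ^+ 2.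

Definition affdim (X : set pt) (k : nat) : Prop :=
  exists (p : pt) (U : 'M[R]_d), \rank U = k /\ X = [set P | (P - p <= U)%MS].
Definition is_flat (X : set pt) : Prop := exists k, affdim X k.

Definition is_proj (t : set pt) (Q P : pt) : Prop :=
  t P /\ forall P1 P2, t P1 -> t P2 ->
    \sum_(c < d) (Q 0 c - P 0 c) * (P1 0 c - P2 0 c) = 0.
Definition proj (t : set pt) (Q : pt) : pt := xget 0 [set P | is_proj t Q P].

Definition sqdist_set (Q : pt) (t : set pt) : R := inf [set sqd Q P | P in t].

(* A real additive gain graph on vertex type V: a finite list (multiset) of
   edges (i, j, g), meaning an edge with endpoints i, j and phi(e;i,j) = g
   (so phi(e;j,i) = -g). *)
Definition gain_graph (V : eqType) := seq (V * V * R).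

Definition switch (V : eqType) (eta : V -> R) (G : gain_graph V) : gain_graph V :=
  [seq (e.1.1, e.1.2, e.2 - eta e.1.1 + eta e.1.2) | e <- G].

Definition collapse (V W : eqType) (f : V -> W) (G : gain_graph V) : gain_graph W :=
  [seq (f e.1.1, f e.1.2, e.2) | e <- G & f e.1.1 != f e.1.2].

Definition hyp (V : eqType) (S : set pt) (Q : V -> pt) (e : V * V * R) : set pt :=
  [set P | S P /\ sqd P (Q e.1.1) - sqd P (Q e.1.2) = e.2].
Definition arr (V : eqType) (S : set pt) (Q : V -> pt) (G : gain_graph V)
  : set (set pt) := [set hyp S Q e | e in [set e | e \in G]].

Definition induced_arr (t : set pt) (H : set (set pt)) : set (set pt) :=
  [set h `&` t | h in [set h | H h /\ ~ (t `<=` h) /\ (h `&` t) !=set0]].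

Definition flats (S : set pt) (H : set (set pt)) : set (set pt) :=
  [set X | X !=set0 /\ exists F, F `<=` H /\ X = S `&` \bigcap_(h in F) h].

Definition poset_iso (A B : set (set pt)) : Prop :=
  exists f : set pt -> set pt,
    (forall X, A X -> B (f X)) /\
    (forall Y, B Y -> exists2 X, A X & f X = Y) /\
    (forall X Y, A X -> A Y -> (X `<=` Y <-> f X `<=` f Y)).

Section Blocks.
Variables (n : nat) (Q : 'I_n -> pt) (t : set pt).
Definition blk (i : 'I_n) : {set 'I_n} := [set j | proj t (Q j) == proj t (Q i)].
Definition part : {set {set 'I_n}} := blk @: [set: 'I_n].
Definition block_t := {B : {set 'I_n} | B \in part}.
Definition cls (i : 'I_n) : block_t := exist _ (blk i) (imset_f blk (in_setT i)).
Definition Qbar (B : block_t) : pt :=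
  if [pick i in val B] is Some i then proj t (Q i) else 0.
Definition eta_t (i : 'I_n) : R := sqdist_set (Q i) t.
End Blocks.

(* ideal general position of points Q : V -> pt in a Euclidean space of
   dimension D (projective span of ideal points written as linear rank of
   the direction vectors, minus one) *)
Definition ncomp (V : finType) (T : {set V * V}) : nat :=
  n_comp (fun x y => ((x, y) \in T) || ((y, x) \in T)) predT.
Definition dirmx (V : finType) (Q : V -> pt) (T : {set V * V}) : 'M[R]_(#|T|, d) :=
  \matrix_(k < #|T|, c < d) (Q (enum_val k).2 0 c - Q (enum_val k).1 0 c).
Definition ideal_gp (V : finType) (D : nat) (Q : V -> pt) : Prop :=
  injective Q /\
  forall T : {set V * V}, \rank (dirmx Q T) = minn (#|V| - ncomp T) D.

Definition flat_of (d' : nat) (p : 'M[R]_(d', d) * 'rV[R]_d') : set pt :=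
  [set P | p.1 *m P^T = p.2^T].
End Defs.
Arguments Qbar {R d n} Q t B.
Arguments cls {R d n} Q t i.
Arguments eta_t {R d n} Q t i.
Arguments blk {R d n} Q t i.
Arguments part {R d n} Q t.
Arguments block_t {R d n} Q t.

(* Main.v *)
(* Every hyperplane h(e) is the solution set of one affine equation, so flats are
   solution sets of affine systems and everything reduces to ranks. For P in t,
   Pythagoras gives d(P, Q_i)^2 = d(P, proj_t Q_i)^2 + eta_t(i), which turns the
   equation of h(e) restricted to t into that of the switched and collapsed edge.
   The flat t = {P : A P^T = b^T} is generic when stacking its equations under each
   of the finitely many systems coming from H (resp. under each matrix of directions
   Q_j - Q_i) gives the largest possible rank: each such rank condition holds off
   the zero set of a function that is a nonzero polynomial on lines, hence on an
   open dense set. For generic t, X |-> X `&` t drops dimension by exactly d' or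
   produces the empty set, and comparing dimensions shows that it reflects
   inclusion. Finally, the kernel of orthogonal projection onto the direction of t
   is the row space of A, so projecting a matrix M of directions has rank
   rank [M; A] - d', which is the value required by ideal general position in t. *)
Require Import Defs.
From HB Require Import structures.
From mathcomp Require Import all_boot all_order all_algebra.
From mathcomp Require Import all_classical all_reals all_analysis.
From mathcomp Require Import zify ring lra.
Import Order.TTheory GRing.Theory Num.Theory.
Import numFieldNormedType.Exports.
Set Implicit Arguments.
Unset Strict Implicit.
Unset Printing Implicit Defensive.
Local Open Scope classical_set_scope.
Local Open Scope ring_scope.

(** * Generic properties and generic ranks of matrix families *)

Definition generically (V : topologicalType) (P : V -> Prop) : Prop :=
  exists2 U : set V, open U /\ dense U & forall p, U p -> P p.

(** A finite intersection of open dense sets is open and dense; here the index ranges over the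
    finitely many edge sets or sets of pairs of points. *)
Lemma generically_all (V : topologicalType) (I : finType) (P : I -> V -> Prop) :
  (forall i, generically (P i)) -> generically (fun p => forall i, P i p).
Proof.
move=> gP; suff [U oU UP] : generically (fun p => forall i, i \in enum I -> P i p).
  by exists U => // p Up i; apply: UP; rewrite ?mem_enum.
elim: (enum I) => [|i s [U [Uo dU] UP]].
  exists setT => //; split; first exact: openT.
  by move=> O O0 _; rewrite setIT.
have [W [Wo dW] WP] := gP i; exists (W `&` U).
  by split; [exact: openI | exact: denseI].
move=> p [Wp Up] j; rewrite inE => /orP[/eqP->|]; [exact: WP | exact: UP].
Qed.

Lemma generically_and (V : topologicalType) (P1 P2 : V -> Prop) :
  generically P1 -> generically P2 -> generically (fun p => P1 p /\ P2 p).
Proof.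
move=> [U1 [Uo1 dU1] UP1] [U2 [Uo2 dU2] UP2]; exists (U1 `&` U2).
  by split; [exact: openI | exact: denseI].
by move=> p [p1 p2]; split; [exact: UP1 | exact: UP2].
Qed.

(** The determinant is taken over the polynomial ring; evaluation at [s] is a ring morphism and
    commutes with it. *)
Lemma det_line (R : comNzRingType) r (A B : 'M[R]_r) :
  exists q : {poly R}, forall s, q.[s] = \det (A + s *: B).
Proof.
exists (\det (map_mx polyC A + 'X *: map_mx polyC B)) => s.
rewrite -horner_evalE -det_map_mx; congr (\det _); apply/matrixP => i j.
by rewrite !mxE /= horner_evalE !hornerE.
Qed.

Lemma nonroot_near0 (R : realFieldType) (q : {poly R}) (e : R) :
  0 < e -> q != 0 -> exists2 s, 0 < s < e & q.[s] != 0.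
Proof.
(* These are [size q] distinct points, more than [q] has roots; starting the denominators at 2 keeps
   them strictly below [e]. *)
move=> e0 q0; pose rs := [seq e / i.+2%:R | i <- iota 0 (size q)].
have : ~~ all (root q) rs.
  apply/negP => rsq; have := max_poly_roots q0 rsq.
  rewrite size_map size_iota ltnn => /contraFF /(_ erefl).
  rewrite map_inj_uniq ?iota_uniq// => i j /(mulfI (lt0r_neq0 e0))/invr_inj/eqP.
  by rewrite eqr_nat => /eqP[].
case/allPn => _ /mapP[i _ ->] nr; exists (e / i.+2%:R) => //.
by rewrite divr_gt0 ?ltr0n//= ltr_pdivrMr ?ltr0n// ltr_pMr// ltr1n.
Qed.

Lemma continuous_sum (R : realType) (V : topologicalType) (I : Type) (s : seq I)
    (f : I -> V -> R) :
  (forall i, continuous (f i)) -> continuous (fun p => \sum_(i <- s) f i p).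
Proof.
move=> cf; elim: s => [|i s IH] p.
  by under eq_fun do rewrite big_nil; exact: cvg_cst.
by under eq_fun do rewrite big_cons; apply: cvgD; [exact: cf | exact: IH].
Qed.

Lemma continuous_prod (R : realType) (V : topologicalType) (I : Type) (s : seq I)
    (f : I -> V -> R) :
  (forall i, continuous (f i)) -> continuous (fun p => \prod_(i <- s) f i p).
Proof.
move=> cf; elim: s => [|i s IH] p.
  by under eq_fun do rewrite big_nil; exact: cvg_cst.
by under eq_fun do rewrite big_cons; apply: cvgM; [exact: cf | exact: IH].
Qed.

Lemma continuous_mulmx (R : realType) (V : topologicalType) m n k
    (F : V -> 'M[R]_(m, n)) (G : V -> 'M[R]_(n, k)) :
  (forall i j, continuous (fun p => F p i j)) ->
  (forall i j, continuous (fun p => G p i j)) ->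
  forall i j, continuous (fun p => (F p *m G p) i j).
Proof.
move=> cF cG i j; under eq_fun do rewrite mxE.
by apply: continuous_sum => l p; apply: cvgM; [exact: cF | exact: cG].
Qed.

Lemma continuous_det (R : realType) (V : topologicalType) n (F : V -> 'M[R]_n) :
  (forall i j, continuous (fun p => F p i j)) -> continuous (fun p => \det (F p)).
Proof.
move=> cF; apply: continuous_sum => s p; apply: cvgM; first exact: cvg_cst.
by apply: continuous_prod => i; exact: cF.
Qed.

(* [F] has rank at least [r] wherever [\det (L *m F p *m C)] is nonzero; with [L]
   and [C] chosen so that this is [1] at [p0], its restriction to any line through
   [p0] is a nonzero polynomial. *)
Lemma generically_rank_ge (R : realType) (V : normedModType R) m n r
    (F F' : V -> 'M[R]_(m, n)) (p0 : V) :
  (forall i j, continuous (fun p => F p i j)) ->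
  (forall x y s, F (x + s *: y) = F x + s *: F' y) ->
  (r <= \rank (F p0))%N ->
  generically (fun p => (r <= \rank (F p))%N).
Proof.
move=> cF linF rF.
(* [L] and [C] undo the two base changes of Gaussian elimination at [p0] and keep an identity block
   of size [r]. *)
pose L : 'M[R]_(r, m) := pid_mx r *m invmx (col_ebase (F p0)).
pose C : 'M[R]_(n, r) := invmx (row_ebase (F p0)) *m pid_mx r.
have [rm rn] : (r <= m)%N /\ (r <= n)%N.
  by split; apply: leq_trans rF _; rewrite ?rank_leq_row ?rank_leq_col.
have LC : L *m F p0 *m C = 1%:M.
  rewrite -{1}(mulmx_ebase (F p0)) /L /C !mulmxA mulmxKV ?col_ebase_unit//.
  rewrite mulmxK ?row_ebase_unit// !mul_pid_mx.
  rewrite (minn_idPl rF) -pid_mx_1; congr (pid_mx _).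
  by rewrite !(minn_idPr _)// ?(minn_idPl _).
pose g p := \det (L *m F p *m C).
have cg : continuous g.
  apply: continuous_det => i j; apply: continuous_mulmx => {i j} i j.
    by apply: continuous_mulmx => // k l p; exact: cvg_cst.
  by move=> p; exact: cvg_cst.
exists [set p | g p != 0]; last first.
  move=> p /= gp; apply: leq_trans (mxrankM_maxr L _).
  apply: leq_trans (mxrankM_maxl _ C).
  by have /mxrank_unit -> : L *m F p *m C \in unitmx by rewrite unitmxE unitfE.
split.
  have -> : [set p | g p != 0] = g @^-1` [set x | x != 0] by [].
  by apply: open_comp => [p _|]; [exact: cg | exact: open_neq].
move=> O [x Ox] oO.
(* [q] is [g] along the line that starts at [x] and reaches [p0] at parameter 1, where its value is
   1; its nonroots near 0 give points of [O] close to [x]. *)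
have [q qE] := det_line (L *m F x *m C) (L *m F' (p0 - x) *m C).
have {}qE s : q.[s] = g (x + s *: (p0 - x)).
  by rewrite qE /g linF mulmxDr mulmxDl -scalemxAr -scalemxAl.
have q0 : q != 0.
  apply: contraTneq (oner_neq0 R) => q0.
  by have := qE 1; rewrite q0 horner0 scale1r subrKC /g LC det1 => <-; rewrite eqxx.
have cl : (fun s : R => x + s *: (p0 - x)) @ 0 --> x.
  rewrite -[X in _ --> X]addr0 -(scale0r (p0 - x)).
  by apply: cvgD; [exact: cvg_cst | apply: cvgZr_tmp; exact: cvg_id].
have /cl /nbhs_ballP[e /= e0 eO] : nbhs x O by exact: open_nbhs_nbhs.
have [s /andP[s0 se] qs] := nonroot_near0 e0 q0.
exists (x + s *: (p0 - x)); split; last by rewrite /= -qE.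
by apply: eO; rewrite /ball/= sub0r normrN gtr0_norm.
Qed.

Lemma complementary_rows (R : fieldType) m n k (M : 'M[R]_(m, n)) :
  exists T : 'M[R]_(k, n), \rank (col_mx M T) = minn (\rank M + k) n.
Proof.
(* Rows taken from a basis of a complement of [M] are independent of [M]; once that basis is
   exhausted the full rank [n] is reached. *)
pose C := (M^C)%MS; exists (pid_mx (minn k (\rank C)) *m row_base C).
set T := _ *m _; have TC : (T <= C)%MS by rewrite mulmx_sub ?eq_row_base.
have rT : \rank T = minn k (\rank C).
  by rewrite mxrankMfree ?row_base_free// rank_pid_mx ?geq_minl ?geq_minr.
have dMT : (M :&: T = 0)%MS.
  by apply/eqP; rewrite -submx0 -(capmx_compl M) capmxS.
rewrite -addsmxE -[LHS]addn0 -[X in (_ + X)%N](mxrank0 R n n) -dMT mxrank_sum_cap rT.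
by rewrite mxrank_compl; have := rank_leq_col M; lia.
Qed.

(** The right-hand side always bounds the rank from above, and surjectivity of [T] provides a point
    where it is attained. By linearity of [T], the linear part of the stacked matrix is
    [col_mx 0 (T p)]. *)
Lemma generically_rank_col_mx (R : realType) (V : normedModType R) m n k
    (M : 'M[R]_(m, n)) (T : V -> 'M[R]_(k, n)) :
  (forall i j, continuous (fun p => T p i j)) ->
  (forall x y s, T (x + s *: y) = T x + s *: T y) ->
  (forall A, exists p, T p = A) ->
  generically (fun p => \rank (col_mx M (T p)) = minn (\rank M + k) n).
Proof.
move=> cT lT sT; have [A rA] := complementary_rows k M; have [p0 p0A] := sT A.
have [|||U oU UP] := @generically_rank_ge R V _ _ (minn (\rank M + k) n)
    (fun p => col_mx M (T p)) (fun p => col_mx 0 (T p)) p0.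
- move=> i j; under eq_fun do rewrite mxE; case: (fintype.split i) => i'; last exact: cT.
  by move=> p; exact: cvg_cst.
- by move=> x y s; rewrite lT scale_col_mx scaler0 add_col_mx addr0.
- by rewrite p0A rA.
exists U => // p Up; apply/eqP; rewrite eqn_leq UP// andbT leq_min rank_leq_col.
by rewrite -addsmxE andbT (leq_trans (mxrank_adds_leqif _ _))// leq_add2l rank_leq_row.
Qed.

(** * Flats, their dimension, and affine systems *)

Lemma poset_iso_sym (R : realType) d (A B : set (set 'rV[R]_d)) :
  poset_iso A B -> poset_iso B A.
Proof.
move=> [f [fAB [fsurj flef]]].
pose g Y := xget set0 [set X | A X /\ f X = Y].
have gP Y : B Y -> A (g Y) /\ f (g Y) = Y.
  move=> BY; apply: (@xgetPex _ set0 [set X | A X /\ f X = Y]).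
  by have [X AX fX] := fsurj _ BY; exists X.
exists g; split; [|split].
- by move=> Y /gP[].
- move=> X AX; exists (f X); first exact: fAB.
  have [AgX fgX] := gP _ (fAB _ AX).
  (* Reflecting inclusions in both directions makes [f] injective on [A]. *)
  by apply/seteqP; split; apply/flef => //; rewrite fgX.
- move=> X Y BX BY; have [AX fX] := gP _ BX; have [AY fY] := gP _ BY.
  by have := flef _ _ AX AY; rewrite fX fY => -[].
Qed.

Lemma affdim_uniq (R : realType) d (X : set 'rV[R]_d) k k' :
  affdim X k -> affdim X k' -> k = k'.
Proof.
suff le_dim l l' : affdim X l -> affdim X l' -> (l <= l')%N.
  by move=> Xk Xk'; apply/eqP; rewrite eqn_leq !le_dim.
move=> [p [U [<- ->]]] [p' [U' [<- XE]]].
have sub u : (u <= U)%MS -> (p + u - p' <= U')%MS.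
  by move=> uU; move/seteqP: XE => -[+ _]; apply; rewrite /= addrC addKr.
(* [u] is the difference of [p + u - p'] and [p - p'], which both lie in [U']. *)
apply/mxrankS/rV_subP => u uU.
have := sub u uU; have := sub 0 (sub0mx _ _); rewrite addr0 => pU /addmx_sub.
move=> /(_ (p' - p)); rewrite -[p' - p]opprB eqmx_opp => /(_ pU).
by rewrite opprB addrA subrK addrC addKr.
Qed.

(* The solution set of the affine system whose row [(a, b)] encodes the
   equation [<a, P> + b = 0]. *)
Definition sol (R : realType) d m (W : 'M[R]_(m, d + 1)) : set 'rV[R]_d :=
  [set P | row_mx P 1%:M *m W^T = 0].

Section AffineSystems.
Context {R : realType} {d : nat}.

Lemma sol_col_mx m1 m2 (W : 'M[R]_(m1, d + 1)) (T : 'M[R]_(m2, d + 1)) :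
  sol (col_mx W T) = sol W `&` sol T.
Proof.
apply/seteqP; split=> P; rewrite /sol /= tr_col_mx mul_mx_row.
  by rewrite -row_mx0 => /eq_row_mx.
by move=> [-> ->]; rewrite row_mx0.
Qed.

Lemma sol_submx m1 m2 (W : 'M[R]_(m1, d + 1)) (T : 'M[R]_(m2, d + 1)) :
  (T <= W)%MS -> sol W `<=` sol T.
Proof.
by move=> /submxP[D ->] P; rewrite /sol /= trmx_mul mulmxA => ->; rewrite mul0mx.
Qed.

Lemma solE m (W : 'M[R]_(m, d + 1)) P :
  sol W P <-> P *m (lsubmx W)^T + (rsubmx W)^T = 0.
Proof.
by rewrite /sol /= -{1}[W]hsubmxK tr_row_mx mul_row_col mul1mx.
Qed.

Lemma sol_rank m (W : 'M[R]_(m, d + 1)) P : sol W P -> \rank W = \rank (lsubmx W).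
Proof.
move=> /solE /eqP; rewrite addrC addr_eq0 => /eqP cE.
(* A solution [P] expresses the constant column through the normals, so [W] is its linear part times
   a matrix with a right inverse. *)
have -> : W = lsubmx W *m row_mx 1%:M (- P^T).
  rewrite mul_mx_row mulmx1 mulmxN -{1}[W]hsubmxK; congr row_mx.
  by apply: trmx_inj; rewrite cE !raddfN /= trmx_mul trmxK.
rewrite mxrankMfree ?mul_mx_row ?mulmx1 ?row_mxKl//.
apply/row_freeP; exists (col_mx 1%:M 0).
by rewrite mul_row_col mulmx0 mulmx1 addr0.
Qed.

Lemma sol_rank_le m (W : 'M[R]_(m, d + 1)) P : sol W P -> (\rank W <= d)%N.
Proof. by move=> /sol_rank ->; exact: rank_leq_col. Qed.

(** The consistency half of the Rouché-Capelli theorem: equal ranks put the constant column in the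
    span of the other columns. *)
Lemma sol_nonempty m (W : 'M[R]_(m, d + 1)) :
  \rank W = \rank (lsubmx W) -> sol W !=set0.
Proof.
move=> rW; have sWl : ((lsubmx W)^T <= W^T)%MS.
  by rewrite -{2}[W]hsubmxK tr_row_mx -addsmxE addsmxSl.
have : (W^T <= (lsubmx W)^T)%MS.
  by have := mxrank_leqif_sup sWl; rewrite !mxrank_tr rW => -[_ <-].
rewrite -{1}[W]hsubmxK tr_row_mx col_mx_sub => /andP[_ /submxP[D cE]].
by exists (- D); apply/solE; rewrite mulNmx cE addNr.
Qed.

Lemma affdim_sol m (W : 'M[R]_(m, d + 1)) P :
  sol W P -> affdim (sol W) (d - \rank W).
Proof.
move=> WP; exists P, (kermx (lsubmx W)^T); split.
  by rewrite mxrank_ker mxrank_tr (sol_rank WP).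
have /solE/eqP := WP; rewrite addr_eq0 => /eqP PE.
apply/seteqP; split=> P'.
  move=> /solE/eqP; rewrite addr_eq0 => /eqP PE'; apply/sub_kermxP.
  by rewrite mulmxBl PE PE' subrr.
move=> /sub_kermxP; rewrite mulmxBl PE opprK => ?; exact/solE.
Qed.

(** Appending [T] to [W] keeps the solution set, hence its dimension, hence the rank. The point [P]
    excludes an inconsistent [W], whose empty solution set lies in every other. *)
Lemma sol_subset m1 m2 (W : 'M[R]_(m1, d + 1)) (T : 'M[R]_(m2, d + 1)) P :
  sol W P -> sol W `<=` sol T -> (T <= W)%MS.
Proof.
move=> WP WT; have WTE : sol (col_mx W T) = sol W.
  by rewrite sol_col_mx; apply: setIidl.
have colP : sol (col_mx W T) P by rewrite WTE.
have := affdim_sol colP; rewrite WTE => /affdim_uniq/(_ (affdim_sol WP)) rE.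
have sW : (W <= col_mx W T)%MS by rewrite -addsmxE addsmxSl.
have : (col_mx W T <= W)%MS.
  have := mxrank_leqif_sup sW => -[_ <-].
  by have := sol_rank_le colP; have := sol_rank_le WP; move: rE; lia.
by rewrite col_mx_sub => /andP[].
Qed.

(** Both the equations and their normals have the largest possible joint rank. For consistent [W]
    the two ranks agree when [\rank W + k <= d], so the joint system is solvable; otherwise they are
    [d + 1] and [d], and it is not. *)
Definition transversal m k (W : 'M[R]_(m, d + 1)) (T : 'M[R]_(k, d + 1)) :=
  \rank (col_mx W T) = minn (\rank W + k) (d + 1) /\
  \rank (col_mx (lsubmx W) (lsubmx T)) = minn (\rank (lsubmx W) + k) d.

Lemma transversal_meets m k (W : 'M[R]_(m, d + 1)) (T : 'M[R]_(k, d + 1)) P :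
  transversal W T -> sol W P -> (\rank W + k <= d)%N -> (sol W `&` sol T) !=set0.
Proof.
move=> [rWT rlWT] WP rd; rewrite -sol_col_mx; apply: sol_nonempty.
rewrite rWT; have -> : lsubmx (col_mx W T) = col_mx (lsubmx W) (lsubmx T).
  by apply/matrixP => i j; rewrite !mxE; case: fintype.split => ?; rewrite !mxE.
by rewrite rlWT -(sol_rank WP); lia.
Qed.

Lemma transversal_rank m k (W : 'M[R]_(m, d + 1)) (T : 'M[R]_(k, d + 1)) P :
  transversal W T -> sol W P -> sol T P ->
  \rank (col_mx W T) = (\rank W + k)%N /\ (\rank W + k <= d)%N.
Proof.
move=> [rWT _] WP TP; have WTP : sol (col_mx W T) P by rewrite sol_col_mx.
by have := sol_rank_le WTP; rewrite rWT; lia.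
Qed.

End AffineSystems.

(** * The inner product and the affine equation of an edge *)

Definition dot (R : realType) d (u v : 'rV[R]_d) : R := (u *m v^T) 0 0.

Section Dot.
Context {R : realType} {d : nat}.
Implicit Types u v w P S : 'rV[R]_d.

Lemma dotE u v : dot u v = \sum_(c < d) u 0 c * v 0 c.
Proof. by rewrite /dot mxE; apply: eq_bigr => c _; rewrite mxE. Qed.

Lemma dotC u v : dot u v = dot v u.
Proof. by rewrite !dotE; apply: eq_bigr => c _; rewrite mulrC. Qed.

Lemma dotDl u v w : dot (u + v) w = dot u w + dot v w.
Proof. by rewrite /dot mulmxDl mxE. Qed.

Lemma dotNl u w : dot (- u) w = - dot u w.
Proof. by rewrite /dot mulNmx mxE. Qed.

Lemma dotBl u v w : dot (u - v) w = dot u w - dot v w.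
Proof. by rewrite dotDl dotNl. Qed.

Lemma dotBr u v w : dot w (u - v) = dot w u - dot w v.
Proof. by rewrite !(dotC w) dotBl. Qed.

Lemma dotZr a u w : dot w (a *: u) = a * dot w u.
Proof. by rewrite /dot linearZ /= -scalemxAr mxE. Qed.

Lemma dot_ge0 u : 0 <= dot u u.
Proof. by rewrite dotE; apply: sumr_ge0 => c _; rewrite -expr2 sqr_ge0. Qed.

Lemma dot_eq0 u : (dot u u == 0) = (u == 0).
Proof.
apply/idP/eqP => [|->]; last by rewrite /dot mul0mx mxE.
rewrite dotE psumr_eq0 => [/allP u0|c _]; last by rewrite -expr2 sqr_ge0.
apply/rowP => c; have := u0 c (mem_index_enum _).
by rewrite mxE -expr2 sqrf_eq0 => /eqP.
Qed.

Lemma sqdE P S : sqd P S = dot (P - S) (P - S).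
Proof. by rewrite dotE; apply: eq_bigr => c _; rewrite !mxE expr2. Qed.

End Dot.

(** In the difference of squared distances the terms quadratic in [P] cancel; these are the
    coefficients of the affine equation that remains. *)
Definition edge_row (R : realType) d (V : eqType) (Q : V -> 'rV[R]_d)
    (e : V * V * R) : 'rV[R]_(d + 1) :=
  row_mx (2 *: (Q e.1.2 - Q e.1.1))
         (dot (Q e.1.1) (Q e.1.1) - dot (Q e.1.2) (Q e.1.2) - e.2)%:M.

Lemma hyp_sol (R : realType) d (V : eqType) (Q : V -> 'rV[R]_d) e :
  hyp setT Q e = sol (edge_row Q e).
Proof.
have solP P : sol (edge_row Q e) P <-> 2 * dot P (Q e.1.2 - Q e.1.1) +
    (dot (Q e.1.1) (Q e.1.1) - dot (Q e.1.2) (Q e.1.2) - e.2) = 0.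
  rewrite /sol /= tr_row_mx mul_row_col mul1mx tr_scalar_mx -dotZr.
  split=> [/rowP/(_ 0)|]; first by rewrite /dot !mxE eqxx mulr1n.
  by rewrite /dot => eP; apply/rowP => c; move: eP; rewrite ord1 !mxE eqxx mulr1n.
apply/seteqP; split=> P.
  move=> [_ eP]; apply/solP; rewrite -eP !sqdE !(dotBl, dotBr).
  by rewrite (dotC _ P) (dotC _ P); ring.
move=> /solP eP; split=> //; apply/eqP; rewrite -subr_eq0; apply/eqP; rewrite -eP.
by rewrite !sqdE !(dotBl, dotBr) !(dotC _ P); ring.
Qed.

(** * Flats of a generic section *)

Section GenericSection.
Context {R : realType} {d n : nat}.
Variables (Phi : gain_graph R 'I_n) (Q : 'I_n -> 'rV[R]_d).
Notation edge := (tnth (in_tuple Phi)).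
Notation H := (arr setT Q Phi).

(** Edges outside [I] contribute zero rows, which impose nothing, so all the systems share one
    matrix size. *)
Definition system (I : {set 'I_(size Phi)}) : 'M[R]_(size Phi, d + 1) :=
  \matrix_k (if k \in I then edge_row Q (edge k) else 0).

Lemma sol_system I P : sol (system I) P <-> forall k, k \in I -> hyp setT Q (edge k) P.
Proof.
split=> [IP k kI|IP].
  rewrite hyp_sol; apply: sol_submx IP.
  by have := row_sub k (system I); rewrite rowK kI.
rewrite /sol /=; apply: trmx_inj; rewrite trmx_mul trmxK trmx0.
apply/row_matrixP => k; rewrite row_mul rowK row0.
case: ifP => [/IP|_]; last by rewrite mul0mx.
by rewrite hyp_sol /sol /= => eP; apply: trmx_inj; rewrite trmx_mul trmxK eP trmx0.
Qed.

Lemma arrP h : H h <-> exists k, h = hyp setT Q (edge k).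
Proof.
split=> [[e /= /(tnthP (in_tuple Phi))[k ->] <-]|[k ->]]; first by exists k.
by exists (edge k) => //=; exact: mem_tnth.
Qed.

Lemma flats_system X :
  flats setT H X <-> X !=set0 /\ exists I, X = sol (system I).
Proof.
split=> [[X0 [F [FH XE]]]|[X0 [I XE]]]; split => //.
  exists [set k | `[< F (hyp setT Q (edge k)) >]]%SET; rewrite XE.
  apply/seteqP; split=> P.
    move=> [_ FP]; apply/sol_system => k; rewrite inE => /asboolP Fk.
    exact: FP Fk.
  move=> /sol_system IP; split=> // h Fh; have /arrP[k hE] := FH _ Fh.
  by rewrite hE; apply: IP; rewrite inE; apply/asboolP; rewrite -hE.
exists [set h | exists2 k, k \in I & h = hyp setT Q (edge k)]; split.
  by move=> h [k _ ->]; apply/arrP; exists k.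
rewrite XE; apply/seteqP; split=> P.
  by move=> /sol_system IP; split=> // h [k kI ->]; exact: IP.
by move=> [_ FP]; apply/sol_system => k kI; apply: FP; exists k.
Qed.

Hypothesis Qadj : forall e, e \in Phi -> Q e.1.1 != Q e.1.2.

Lemma edge_row_neq0 k : edge_row Q (edge k) != 0.
Proof.
have := Qadj (mem_tnth k (in_tuple Phi)); apply: contraNneq => /eqP.
by rewrite row_mx_eq0 scaler_eq0 pnatr_eq0 /= subr_eq0 eq_sym => /andP[].
Qed.

Lemma transversal_section_iso k (T : 'M[R]_(k, d + 1)) :
  \rank T = k -> (forall I, transversal (system I) T) ->
  poset_iso (flats (sol T) (induced_arr (sol T) H))
            [set X | flats setT H X /\ exists2 l, (k <= l)%N & affdim X l].
Proof.
move=> rT trT; apply: poset_iso_sym; exists (fun X => X `&` sol T).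
(* For a consistent system, dimension at least [k] means that [k] further independent equations
   still fit. *)
have dimE I P l : sol (system I) P -> affdim (sol (system I)) l ->
    (k <= l)%N -> (\rank (system I) + k <= d)%N.
  move=> IP /affdim_uniq/(_ (affdim_sol IP)) ->.
  by have := sol_rank_le IP; lia.
split; [|split].
- move=> X [/flats_system[[P0 IP0] [I XE]] [l kl Xl]]; subst X.
  have [P [IP TP]] := transversal_meets (trT I) IP0 (dimE _ _ _ IP0 Xl kl).
  split; first by exists P.
  exists [set h' | exists2 j, j \in I & h' = hyp setT Q (edge j) `&` sol T]; split.
    move=> _ [j jI ->]; exists (hyp setT Q (edge j)) => //; split; [|split].
    + by apply/arrP; exists j.
    (* If the hyperplane contained [sol T], its row would lie in the row space of [T];
       transversality would then force that row to be zero. *)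
    + move=> Tj; have jP : sol (system [set j]) P.
        apply/sol_system => i; rewrite inE => /eqP ->.
        by move/sol_system: IP; apply.
      have /(sol_subset TP) sT : sol T `<=` sol (system [set j]).
        by move=> S /Tj ?; apply/sol_system => i; rewrite inE => /eqP ->.
      have [rE _] := transversal_rank (trT [set j]%SET) jP TP.
      have : \rank (col_mx (system [set j]%SET) T) = \rank T.
        by rewrite -addsmxE (addsmx_idPr sT).
      rewrite rE rT => /(canRL (addnK _)); rewrite subnn => /eqP.
      rewrite mxrank_eq0 => /eqP/(congr1 (row j)); rewrite rowK inE eqxx row0.
      by apply/eqP; exact: edge_row_neq0.
    + by exists P; split=> //; move/sol_system: IP; apply.
  apply/seteqP; split=> S.
    move=> [/sol_system IS TS]; split=> // _ [j jI ->]; split => //; exact: IS.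
  move=> [TS FS]; split=> //; apply/sol_system => j jI.
  by have [] : (hyp setT Q (edge j) `&` sol T) S by apply: FS; exists j.
- move=> Y [[P YP] [F [FH YE]]].
  (* For surjectivity, collect every edge whose trace on [sol T] belongs to [F]; a common point of
     the two systems then yields the dimension bound. *)
  pose I := [set j | `[< F (hyp setT Q (edge j) `&` sol T) >]]%SET.
  have IE : sol (system I) `&` sol T = Y.
    rewrite YE; apply/seteqP; split=> S.
      move=> [/sol_system IS TS]; split=> // h' Fh'.
      have [h [/arrP[j hE] _] h'E] := FH _ Fh'; rewrite -h'E hE; split=> //.
      by apply: IS; rewrite inE; apply/asboolP; rewrite -hE h'E.
    move=> [TS FS]; split=> //; apply/sol_system => j; rewrite inE => /asboolP Fj.
    by have [] := FS _ Fj.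
  exists (sol (system I)) => //.
  have [IP TP] : (sol (system I) `&` sol T) P by rewrite IE.
  split; first by apply/flats_system; split; [exists P | exists I].
  exists (d - \rank (system I))%N; last exact: affdim_sol IP.
  by have [_] := transversal_rank (trT I) IP TP; lia.
- move=> X Y [/flats_system[[P0 IP0] [I XE]] [l kl Xl]] [/flats_system[_ [J YE]] _].
  subst X Y; split=> [|XY]; first exact: setSI.
  have [P [IP TP]] := transversal_meets (trT I) IP0 (dimE _ _ _ IP0 Xl kl).
  (* To reflect inclusion, compare [I] with the union of [I] and [J]: their sections coincide, so
     their ranks agree and the equations of [J] follow from those of [I]. *)
  have UE : sol (system (I :|: J)) = sol (system I) `&` sol (system J).
    apply/seteqP; split=> S.
      move=> /sol_system US; split; apply/sol_system => j jI; apply: US;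
        by rewrite inE jI ?orbT.
    by move=> [/sol_system IS /sol_system JS]; apply/sol_system => j /setUP[/IS|/JS].
  have [JP _] := XY P (conj IP TP).
  have UP : sol (system (I :|: J)) P by rewrite UE.
  have UTE : sol (col_mx (system (I :|: J)) T) = sol (col_mx (system I) T).
    rewrite !sol_col_mx UE setIAC; apply: setIidl; exact: subset_trans XY (@subIsetl _ _ _).
  have ITP : sol (col_mx (system I) T) P by rewrite sol_col_mx.
  have UTP : sol (col_mx (system (I :|: J)) T) P by rewrite UTE.
  have := affdim_sol UTP; rewrite UTE => /affdim_uniq/(_ (affdim_sol ITP)).
  have [-> rU] := transversal_rank (trT _) UP TP.
  have [-> rI] := transversal_rank (trT _) IP TP => rUI.
  have sIU : (system I <= system (I :|: J))%MS.
    by apply: (sol_subset UP); rewrite UE; exact: subIsetl.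
  have : (system (I :|: J) <= system I)%MS.
    by have := mxrank_leqif_sup sIU => -[_ <-]; lia.
  by move=> /sol_submx; rewrite UE subsetI => -[].
Qed.

End GenericSection.

(** * Orthogonal projection onto an affine flat *)

Definition orthoproj (R : realType) d (U : 'M[R]_d) : 'M[R]_d :=
  proj_mx U (kermx U^T).

Lemma inf_attained (R : realType) (E : set R) x : E x -> lbound E x -> inf E = x.
Proof.
move=> Ex lEx; apply/eqP; rewrite eq_le lb_le_inf ?andbT//; last by exists x.
by apply: ge_inf => //; exists x.
Qed.

Section Projection.
Context {R : realType} {d : nat}.
Implicit Types (U : 'M[R]_d) (S P : 'rV[R]_d) (t : set 'rV[R]_d).

Lemma orthomx_dot m (U : 'M[R]_(m, d)) u v :
  (u <= U)%MS -> (v <= kermx U^T)%MS -> dot v u = 0.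
Proof.
move=> /submxP[x ->] /sub_kermxP vU.
by rewrite /dot trmx_mul mulmxA vU mul0mx mxE.
Qed.

(** A vector in both spaces is orthogonal to itself, and the inner product is positive definite. *)
Lemma capmx_orthomx U : (U :&: kermx U^T = 0)%MS.
Proof.
apply/eqP/rowV0P => v; rewrite sub_capmx => /andP[vU vO].
by apply/eqP; rewrite -dot_eq0 (orthomx_dot vU vO).
Qed.

Lemma addsmx_orthomx U m (W : 'M[R]_(m, d)) : (W <= U + kermx U^T)%MS.
Proof.
apply: submx_full; rewrite /row_full -[X in X == _]addn0.
rewrite -[X in (_ + X)%N](mxrank0 R d d) -(capmx_orthomx U) mxrank_sum_cap.
by rewrite mxrank_ker mxrank_tr subnKC ?rank_leq_col.
Qed.

Lemma kermx_orthoproj U : (kermx (orthoproj U) :=: kermx U^T)%MS.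
Proof.
apply/eqmxP/andP; split.
  have := proj_mx_compl_sub (addsmx_orthomx U (kermx (orthoproj U))).
  by rewrite mulmx_ker subr0.
by apply/sub_kermxP; apply: proj_mx_0; [exact: capmx_orthomx | exact: submx_refl].
Qed.

Lemma is_proj_orthoproj t p U S : t = [set P | (P - p <= U)%MS] ->
  is_proj t S (p + (S - p) *m orthoproj U).
Proof.
move=> ->; split; first by rewrite /= addrC addKr; exact: proj_mx_sub.
move=> P1 P2 /= P1t P2t.
have dU : (P1 - P2 <= U)%MS.
  have -> : P1 - P2 = (P1 - p) - (P2 - p) by rewrite opprB addrA subrK.
  by rewrite addmx_sub// eqmx_opp.
have dO : (S - (p + (S - p) *m orthoproj U) <= kermx U^T)%MS.
  by rewrite opprD addrA; apply: proj_mx_compl_sub; exact: addsmx_orthomx.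
apply: etrans (orthomx_dot dU dO); rewrite dotE; apply: eq_bigr => c _.
by congr (_ * _); rewrite [in RHS]mxE [X in _ = _ + X]mxE.
Qed.

Lemma is_proj_dot t S P P1 P2 :
  is_proj t S P -> t P1 -> t P2 -> dot (S - P) (P1 - P2) = 0.
Proof.
move=> [_ SP] P1t P2t; rewrite dotE; apply: etrans (SP _ _ P1t P2t); apply: eq_bigr => c _.
by rewrite !mxE.
Qed.

Lemma is_proj_uniq t S P P' : is_proj t S P -> is_proj t S P' -> P = P'.
Proof.
move=> SP SP'; have [tP _] := SP; have [tP' _] := SP'.
apply/eqP; rewrite -subr_eq0 -dot_eq0.
have -> : dot (P - P') (P - P') = dot (S - P') (P - P') - dot (S - P) (P - P').
  by rewrite -dotBl; congr dot; rewrite opprB [RHS]addrC addrA subrK.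
by rewrite (is_proj_dot SP')// (is_proj_dot SP)// subrr.
Qed.

Lemma is_proj_proj t S : is_flat t -> is_proj t S (Defs.proj t S).
Proof.
move=> [k [p [U [_ tE]]]]; apply: (@xgetPex _ 0 [set P | is_proj t S P]).
by eexists; exact: is_proj_orthoproj tE.
Qed.

Lemma proj_orthoproj t p U S : t = [set P | (P - p <= U)%MS] ->
  Defs.proj t S = p + (S - p) *m orthoproj U.
Proof.
move=> tE; have tf : is_flat t by exists (\rank U), p, U.
exact: is_proj_uniq (is_proj_proj S tf) (is_proj_orthoproj S tE).
Qed.

(** Pythagoras for the right angle at the foot of the perpendicular from [S]. *)
Lemma sqd_proj t S P : is_flat t -> t P ->
  sqd P S = sqd P (Defs.proj t S) + sqd S (Defs.proj t S).
Proof.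
move=> tf tP; have SQ := is_proj_proj S tf; set Q := Defs.proj t S in SQ *.
have [tQ _] := SQ; have SQP := is_proj_dot SQ tP tQ.
have := SQP; have := SQP; rewrite {2}dotC !sqdE !(dotBl, dotBr).
rewrite (dotC _ P) (dotC Q S); lra.
Qed.

Lemma sqdist_set_proj t S : is_flat t -> sqdist_set S t = sqd S (Defs.proj t S).
Proof.
move=> tf; have [tQ _] := is_proj_proj S tf.
apply: inf_attained; first by exists (Defs.proj t S).
move=> _ [P tP <-]; have -> : sqd S P = sqd P S by rewrite !sqdE !(dotBl, dotBr); ring.
by rewrite (sqd_proj S tf tP) lerDr sqdE dot_ge0.
Qed.

End Projection.

(** * The induced arrangement through switching and collapsing *)

Section Collapse.
Context {R : realType} {d n : nat}.
Variables (Q : 'I_n -> 'rV[R]_d) (t : set 'rV[R]_d).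

Lemma blk_eq i j : (blk Q t i == blk Q t j) = (Defs.proj t (Q i) == Defs.proj t (Q j)).
Proof.
apply/eqP/eqP => [/setP/(_ i)|ij]; last by apply/setP => k; rewrite !inE ij.
by rewrite !inE eqxx => /esym/eqP.
Qed.

Lemma cls_eq i j : (cls Q t i == cls Q t j) = (Defs.proj t (Q i) == Defs.proj t (Q j)).
Proof. by rewrite -val_eqE /= blk_eq. Qed.

Lemma Qbar_cls i : Qbar Q t (cls Q t i) = Defs.proj t (Q i).
Proof.
rewrite /Qbar /=; case: pickP => [j|/(_ i)]; first by rewrite inE => /eqP.
by rewrite inE eqxx.
Qed.

Lemma cls_surj B : exists i, cls Q t i == B.
Proof.
have /imsetP[i _ BE] := valP B.
by exists i; rewrite -val_eqE /= BE.
Qed.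

Hypothesis tf : is_flat t.

Lemma hyp_in_flat e P : t P ->
  hyp setT Q e P <->
  hyp t (Qbar Q t) (cls Q t e.1.1, cls Q t e.1.2,
                    e.2 - eta_t Q t e.1.1 + eta_t Q t e.1.2) P.
Proof.
move=> tP; rewrite /hyp /= !Qbar_cls /eta_t !sqdist_set_proj//.
rewrite (sqd_proj (Q e.1.1) tf tP) (sqd_proj (Q e.1.2) tf tP).
by split=> -[_ eP]; split=> //; move: eP; lra.
Qed.

(** An edge with distinct projected endpoints therefore cuts [t] in a set that is neither empty nor
    all of [t]. *)
Lemma sqd_diff_level P1 P2 g : t P1 -> t P2 -> P1 != P2 ->
  exists2 P, t P & sqd P P1 - sqd P P2 = g.
Proof.
have [k [p [U [_ tE]]]] := tf; rewrite tE /= => P1t P2t P12.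
have D0 : dot (P2 - P1) (P2 - P1) != 0 by rewrite dot_eq0 subr_eq0 eq_sym.
(* At parameter [s] the difference is [(2 * s - 1)] times the squared length of [P2 - P1]; this [s]
   makes it [g]. *)
pose s := (g / dot (P2 - P1) (P2 - P1) + 1) / 2.
exists (P1 + s *: (P2 - P1)).
  have -> : P1 + s *: (P2 - P1) - p = (P1 - p) + s *: ((P2 - p) - (P1 - p)).
    by rewrite opprB addrA subrK addrAC.
  by rewrite /= addmx_sub// scalemx_sub// addmx_sub// eqmx_opp.
have -> : sqd (P1 + s *: (P2 - P1)) P1 = s ^+ 2 * dot (P2 - P1) (P2 - P1).
  by rewrite sqdE addrC addKr dotZr dotC dotZr expr2 mulrA.
have -> : sqd (P1 + s *: (P2 - P1)) P2 = (s - 1) ^+ 2 * dot (P2 - P1) (P2 - P1).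
  have -> : sqd (P1 + s *: (P2 - P1)) P2
      = dot ((s - 1) *: (P2 - P1)) ((s - 1) *: (P2 - P1)).
    by rewrite sqdE; congr dot; rewrite scalerBl scale1r opprB addrAC addrC.
  by rewrite dotZr dotC dotZr expr2 mulrA.
by rewrite /s; field.
Qed.

Lemma induced_arr_collapse (Phi : gain_graph R 'I_n) :
  induced_arr t (arr setT Q Phi) =
  arr t (Qbar Q t) (collapse (cls Q t) (switch (eta_t Q t) Phi)).
Proof.
have hypI e : hyp setT Q e `&` t = hyp t (Qbar Q t)
    (cls Q t e.1.1, cls Q t e.1.2, e.2 - eta_t Q t e.1.1 + eta_t Q t e.1.2).
  apply/seteqP; split=> P; first by move=> [eP tP]; exact/hyp_in_flat.
  by move=> eP; have [tP _] := eP; split=> //; exact/hyp_in_flat.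
have edgeP e' : e' \in collapse (cls Q t) (switch (eta_t Q t) Phi) <->
    exists e, [/\ e \in Phi, cls Q t e.1.1 != cls Q t e.1.2 &
    e' = (cls Q t e.1.1, cls Q t e.1.2, e.2 - eta_t Q t e.1.1 + eta_t Q t e.1.2)].
  split=> [/mapP[e1]|[e [ePhi ce ->]]].
    by rewrite mem_filter => /andP[ce /mapP[e ePhi e1E]] ->; exists e; rewrite e1E in ce *.
  apply/mapP; exists (e.1.1, e.1.2, e.2 - eta_t Q t e.1.1 + eta_t Q t e.1.2) => //.
  by rewrite mem_filter /= ce /=; apply/mapP; exists e.
apply/seteqP; split=> h.
  move=> [_ [[e /= ePhi <-] [nt [P [eP tP]]]] <-]; rewrite hypI.
  eexists; last reflexivity; apply/edgeP; exists e; split=> //.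
  (* When the projected endpoints agree, the equation is constant on [t], so one solution in [t]
     puts all of [t] in the hyperplane. *)
  apply: contra_notN nt; rewrite cls_eq => /eqP ce S tS.
  move: eP => /(hyp_in_flat _ tP) [_ /= eP]; apply/(hyp_in_flat _ tS); split=> //=.
  by move: eP; rewrite !Qbar_cls ce !subrr.
move=> [_ /edgeP[e [ePhi ce ->]] <-]; rewrite -hypI.
exists (hyp setT Q e) => //; split; first by exists e.
have [tPi _] := is_proj_proj (Q e.1.1) tf; have [tPj _] := is_proj_proj (Q e.1.2) tf.
rewrite cls_eq in ce; split; last first.
  have [P tP Pg] := sqd_diff_level (e.2 - eta_t Q t e.1.1 + eta_t Q t e.1.2) tPi tPj ce.
  by exists P; rewrite hypI; split=> //=; rewrite !Qbar_cls.
(* A point of [t] at the level shifted by 1 lies off the hyperplane. *)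
have [P tP Pg] := sqd_diff_level (e.2 - eta_t Q t e.1.1 + eta_t Q t e.1.2 + 1) tPi tPj ce.
move=> /(_ P tP) /(hyp_in_flat _ tP) [_ /=]; rewrite !Qbar_cls Pg => /eqP.
by rewrite -subr_eq0 addrC addKr oner_eq0.
Qed.

End Collapse.

(** * Ideal general position under projection *)

Lemma row_dirmx (R : realType) d (V : finType) (Q : V -> 'rV[R]_d)
    (T : {set V * V}) k :
  row k (dirmx Q T) = Q (enum_val k).2 - Q (enum_val k).1.
Proof. by apply/rowP => c; rewrite !mxE. Qed.

Lemma dirmx_sub (R : realType) d (V : finType) (Q : V -> 'rV[R]_d)
    (T : {set V * V}) m (M : 'M[R]_(m, d)) :
  reflect (forall x, x \in T -> (Q x.2 - Q x.1 <= M)%MS) (dirmx Q T <= M)%MS.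
Proof.
apply: (iffP row_subP) => [QM x xT|QM k]; last by rewrite row_dirmx QM ?enum_valP.
by have := QM (enum_rank_in xT x); rewrite row_dirmx enum_rankK_in.
Qed.

Lemma dirmxM (R : realType) d (V : finType) (Q : V -> 'rV[R]_d)
    (T : {set V * V}) (M : 'M[R]_d) :
  dirmx Q T *m M = dirmx (fun i => Q i *m M) T.
Proof.
by apply/row_matrixP => k; rewrite row_mul !row_dirmx mulmxBl.
Qed.

Lemma ncomp_bij (V W : finType) (r : V -> W) (T : {set V * V}) :
  bijective r -> ncomp [set (r x.1, r x.2) | x in T]%SET = ncomp T.
Proof.
move=> br; have rI := bij_inj br.
have pI : injective (fun x : V * V => (r x.1, r x.2)).
  by move=> [a b] [a' b'] [/rI -> /rI ->].
have symT (X : finType) (S : {set X * X}) :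
    connect_sym (fun x y => ((x, y) \in S) || ((y, x) \in S)).
  by apply: sym_connect_sym => x y; rewrite orbC.
apply: (adjunction_n_comp r (symT _ _) (symT _ _)) => //.
apply: strict_adjunction => //.
  by have [s _ sK] := br; apply/fintype.subsetP => y _; apply/codomP; exists (s y); rewrite sK.
move=> x y _ /=; rewrite -[(r x, r y)]/((fun z => (r z.1, r z.2)) (x, y)).
rewrite -[(r y, r x)]/((fun z => (r z.1, r z.2)) (y, x)).
by rewrite !(mem_imset _ _ pI).
Qed.

Section IdealGeneralPosition.
Context {R : realType} {d n k : nat}.
Variables (Q : 'I_n -> 'rV[R]_d) (A : 'M[R]_(k, d)) (b : 'rV[R]_k).
Hypothesis rA : \rank A = k.
Notation t := (flat_of (A, b)).

Lemma flat_of_direction : exists p, t = [set P | (P - p <= kermx A^T)%MS].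
Proof.
have /row_freeP[B AB] : row_free A by rewrite /row_free rA.
exists (B *m b^T)^T; have BP : A *m (B *m b^T) = b^T by rewrite mulmxA AB mul1mx.
apply/seteqP; split=> P.
  move=> /= AP; apply/sub_kermxP; apply: trmx_inj.
  by rewrite trmx_mul trmxK raddfB /= trmxK mulmxBr AP BP subrr trmx0.
move=> /sub_kermxP/(congr1 trmx); rewrite trmx_mul trmxK raddfB /= trmxK mulmxBr BP trmx0.
by move=> /eqP; rewrite subr_eq0 => /eqP.
Qed.

(** A double orthogonal complement: one inclusion is immediate and the ranks agree. *)
Lemma flat_of_orthomx : (kermx (kermx A^T)^T :=: A)%MS.
Proof.
have sA : (A <= kermx (kermx A^T)^T)%MS.
  by apply/sub_kermxP; apply: trmx_inj; rewrite trmx_mul trmxK mulmx_ker trmx0.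
apply/eqmx_sym/eqmxP; rewrite sA /=; have := mxrank_leqif_sup sA => -[_ <-].
by rewrite mxrank_ker mxrank_tr mxrank_ker mxrank_tr subKn ?rank_leq_col.
Qed.

Notation Pi := (orthoproj (kermx A^T)).

Lemma rank_orthoproj m (M : 'M[R]_(m, d)) :
  \rank (col_mx M A) = minn (\rank M + k) d ->
  \rank (M *m Pi) = minn (\rank M) (d - k).
Proof.
rewrite -addsmxE => rMA.
(* Rank-nullity for [Pi] on the row space of [M]; the kernel part becomes the intersection with [A],
   whose rank the stacked matrix determines. *)
have rMP : (\rank (M *m Pi) + \rank (M :&: kermx Pi) = \rank M)%N.
  exact: mxrank_mul_ker.
have := mxrank_sum_cap M A.
have -> : \rank (M :&: A) = \rank (M :&: kermx Pi).
  apply/eqmx_rank/eqmxP; apply: cap_eqmx => //.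
  by apply: eqmx_trans (eqmx_sym flat_of_orthomx) _; exact: eqmx_sym (kermx_orthoproj _).
have := rank_leq_col A; rewrite rMA rA; lia.
Qed.

Lemma ideal_gp_section :
  (forall T, \rank (col_mx (dirmx Q T) A) = minn (\rank (dirmx Q T) + k) d) ->
  ideal_gp d Q -> ideal_gp (d - k) (Qbar Q t).
Proof.
move=> rQA [Qinj Qgp]; have [p tE] := flat_of_direction.
have projE S : Defs.proj t S = p + (S - p) *m Pi by exact: proj_orthoproj.
have projB i j :
    Defs.proj t (Q j) - Defs.proj t (Q i) = (Q j - Q i) *m Pi.
  by rewrite !projE opprD addrACA subrr add0r -mulmxBl opprB addrA subrK.
have rP T : \rank (dirmx Q T *m Pi) = minn (\rank (dirmx Q T)) (d - k).
  exact: rank_orthoproj.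
(* [r] picks a representative of each block, turning directions between blocks into projected
   directions between the original points. *)
pose r B := xchoose (cls_surj (Q := Q) (t := t) B).
have rK B : cls Q t (r B) = B.
  by apply/eqP; exact: (xchooseP (cls_surj B)).
have QbarE B : Qbar Q t B = Defs.proj t (Q (r B)) by rewrite -{1}(rK B) Qbar_cls.
split=> [B C|T].
  by rewrite !QbarE => BC; rewrite -(rK B) -(rK C); apply/eqP; rewrite cls_eq BC.
have -> : \rank (dirmx (Qbar Q t) T)
    = \rank (dirmx Q [set (r x.1, r x.2) | x in T]%SET *m Pi).
  rewrite dirmxM; apply/eqmx_rank/andP; split.
    apply/dirmx_sub => x xT; rewrite !QbarE projB mulmxBl.
    set M := dirmx _ _; have /dirmx_sub/(_ (r x.1, r x.2)) := submx_refl M.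
    by apply; apply/imsetP; exists x.
  apply/dirmx_sub => _ /imsetP[x xT ->] /=; rewrite -mulmxBl -projB -!QbarE.
  by have /dirmx_sub/(_ x xT) := submx_refl (dirmx (Qbar Q t) T).
(* If [d = k] the flat is a point and both sides vanish. *)
rewrite rP; have [dk0|dk0] := posnP (d - k)%N; first by rewrite dk0 !minn0.
(* In positive dimension all blocks are singletons: the nonzero direction between two distinct
   points has rank 1, which the projection preserves. *)
have clsK : cancel (cls Q t) r.
  move=> i; set j := r _; have ij : cls Q t j = cls Q t i by exact: rK.
  apply/eqP/negPn/negP => /eqP nij.
  have := rP [set (i, j)]%SET; have -> : dirmx Q [set (i, j)] *m Pi = 0.
    rewrite dirmxM; apply/eqP; rewrite -submx0; apply/dirmx_sub => x.
    rewrite inE => /eqP -> /=; rewrite -mulmxBl -projB submx0 subr_eq0.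
    by rewrite -cls_eq ij.
  have : (0 < \rank (dirmx Q [set (i, j)]%SET))%N.
    rewrite lt0n mxrank_eq0; apply/eqP => Q0; apply: nij.
    have /dirmx_sub/(_ (i, j)) : (dirmx Q [set (i, j)]%SET <= (0 : 'M[R]_d))%MS.
      by rewrite Q0 sub0mx.
    by rewrite inE eqxx => /(_ isT); rewrite submx0 subr_eq0 => /eqP/Qinj.
  by rewrite mxrank0; lia.
have br : bijective r by exists (cls Q t).
rewrite Qgp (ncomp_bij T br) (bij_eq_card br) card_ord; lia.
Qed.

End IdealGeneralPosition.

(** * Genericity in the space of parameters of flats *)

Definition flat_matrix (R : realType) d k (p : 'M[R]_(k, d) * 'rV[R]_k) :
  'M[R]_(k, d + 1) := row_mx p.1 (- p.2^T).

Section FlatMatrix.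
Context {R : realType} {d k : nat}.
Notation V := ('M[R]_(k, d) * 'rV[R]_k)%type.
Implicit Type p : V.

Lemma flat_of_sol p : flat_of p = sol (flat_matrix p).
Proof.
apply/seteqP; split=> P.
  move=> /= pP; apply/solE; rewrite row_mxKl row_mxKr raddfN /= trmxK.
  by apply: trmx_inj; rewrite raddfB /= trmx_mul trmxK pP subrr trmx0.
move=> /solE; rewrite row_mxKl row_mxKr raddfN /= trmxK => /eqP; rewrite subr_eq0.
by move=> /eqP/(congr1 trmx); rewrite trmx_mul trmxK.
Qed.

Lemma continuous_fst_coord i j : continuous (fun p => p.1 i j).
Proof.
move=> p; apply: (@continuous_comp _ _ _ fst (fun M : 'M[R]_(k, d) => M i j)).
  exact: cvg_fst.
exact: coord_continuous.
Qed.

Lemma continuous_snd_coord i j : continuous (fun p => p.2 i j).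
Proof.
move=> p; apply: (@continuous_comp _ _ _ snd (fun M : 'rV[R]_k => M i j)).
  exact: cvg_snd.
exact: coord_continuous.
Qed.

Lemma generically_rank_normals m (M : 'M[R]_(m, d)) :
  generically (fun p => \rank (col_mx M p.1) = minn (\rank M + k) d).
Proof.
apply: generically_rank_col_mx => //; first exact: continuous_fst_coord.
by move=> A; exists (A, 0).
Qed.

Lemma generically_rank_equations m (W : 'M[R]_(m, d + 1)) :
  generically (fun p => \rank (col_mx W (flat_matrix p)) = minn (\rank W + k) (d + 1)).
Proof.
apply: generically_rank_col_mx.
- move=> i j; have -> : (fun p => flat_matrix p i j) = (fun p =>
      match fintype.split j with inl c => p.1 i c | inr c => - p.2 c i end).
    by apply/funext => p; rewrite mxE; case: (fintype.split j) => c; rewrite ?mxE.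
  case: (fintype.split j) => c; first exact: continuous_fst_coord.
  by move=> p; apply: continuousN; exact: continuous_snd_coord.
- by move=> x y s; rewrite /flat_matrix scale_row_mx add_row_mx /= scalerN -opprD linearD linearZ.
- move=> A; exists (lsubmx A, - (rsubmx A)^T).
  by rewrite /flat_matrix /= raddfN /= trmxK opprK hsubmxK.
Qed.

Lemma generically_transversal m (W : 'M[R]_(m, d + 1)) :
  generically (fun p => transversal W (flat_matrix p)).
Proof.
have [U oU UP] := generically_and (generically_rank_equations W)
                                  (generically_rank_normals (lsubmx W)).
by exists U => // p /UP[? ?]; split=> //; rewrite row_mxKl.
Qed.

End FlatMatrix.

Theorem theorem7p1 (R : realType) (d n : nat) (Phi : gain_graph R 'I_n)
  (Q : 'I_n -> 'rV[R]_d) :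
  (forall e, e \in Phi -> e.1.1 != e.1.2) ->
  (forall e, e \in Phi -> Q e.1.1 != Q e.1.2) ->
  let H := arr setT Q Phi in
  (* (1) for every affine flat t *)
  (forall t : set 'rV[R]_d, is_flat t ->
     induced_arr t H =
     arr t (Qbar Q t) (collapse (cls Q t) (switch (eta_t Q t) Phi)))
  /\
  (* (2) generic flats of codimension d' *)
  (forall d' : nat,
     exists2 U : set ('M[R]_(d', d) * 'rV[R]_d'), open U /\ dense U &
       forall p, U p -> \rank p.1 = d' ->
         poset_iso (flats (flat_of p) (induced_arr (flat_of p) H))
                   [set X | flats setT H X /\ exists2 k, (d' <= k)%N & affdim X k])
  /\
  (* (3) ideal general position is inherited by generic projections *)
  (ideal_gp d Q ->
   forall d' : nat,
     exists2 U : set ('M[R]_(d', d) * 'rV[R]_d'), open U /\ dense U &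
       forall p, U p -> \rank p.1 = d' ->
         ideal_gp (d - d') (Qbar Q (flat_of p))).
Proof.
move=> _ Qadj H; split; first by move=> t tf; exact: induced_arr_collapse.
split=> [d'|Qgp d'].
  have [U oU UP] := generically_all (fun I : {set 'I_(size Phi)} =>
    generically_transversal (k := d') (system Q I)).
  exists U => // -[A b] Up /= rA; rewrite flat_of_sol.
  apply: (transversal_section_iso Qadj) => [|I]; last exact: UP.
  (* Discarding the constant column recovers [A], so the matrix of equations also has rank [d']. *)
  have AE : A = flat_matrix (A, b) *m col_mx 1%:M 0.
    by rewrite mul_row_col mulmx1 mulmx0 addr0.
  apply/eqP; rewrite eqn_leq rank_leq_row /=.
  by apply: leq_trans (mxrankM_maxl _ (col_mx 1%:M 0)); rewrite -AE rA.
have [U oU UP] := generically_all (fun T : {set 'I_n * 'I_n} =>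
  generically_rank_normals (k := d') (dirmx Q T)).
exists U => // -[A b] Up /= rA.
by apply: ideal_gp_section => // T; exact: (UP _ Up T).
Qed.
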